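(* Let $\psi:\mathbb{R}\to(0,1]$ be a monotonically decreasing function such that $\psi(x)\ge 2/(x-1)$ for all sufficiently large $x>1$, and let $\sigma\in\Sigma$ be such that for all sufficiently large $n\ge2$ and all $1\le k\le n-1$ we have $\sigma^*(k,n-k)\le\psi(n)$. Then \[ \mathcal{D}_{\sigma}(n) \in \mathcal{O}\left(\psi\left(\tfrac{1}{2}\log_4(n)\right)\cdot n\right). \]
   Context: Binary trees are terms over a leaf symbol $a$ and a binary symbol $f$: $a$ is a binary tree, and if $t_1,t_2$ are binary trees then so is $f(t_1,t_2)$. $\mathcal{T}$ is the set of binary trees, $|t|$ the number of leaves of $t$, $\mathcal{T}_n$ the set of binary trees with $n$ leaves. $|\mathcal{D}_t|$ (the size of the minimal DAG of $t$) is the number of pairwise non-isomorphic subtrees of $t$. $\Sigma$ is the set of functions $\sigma:(\mathbb{N}\setminus\{0\})^2\to[0,1]$ with $\sum_{i,j\ge1,\, i+j=k}\sigma(i,j)=1$ for every integer $k\ge2$. For $\sigma\in\Sigma$, $P_\sigma$ is defined by $P_\sigma(a)=1$ and $P_\sigma(f(u,v))=\sigma(|u|,|v|)P_\sigma(u)P_\sigma(v)$, and $\mathcal{D}_\sigma(n)=\sum_{t\in\mathcal{T}_n}P_\sigma(t)|\mathcal{D}_t|$. Further $\sigma^*(i,j)=\sigma(i,j)+\sigma(j,i)$ if $i\ne j$ and $\sigma^*(i,i)=\sigma(i,i)$. *)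

(* Defs.v *)
From HB Require Import structures.
From mathcomp Require Import all_boot all_order all_algebra.
From mathcomp Require Import all_classical all_reals all_analysis.

Set Implicit Arguments.
Unset Strict Implicit.
Unset Printing Implicit Defensive.

Import Order.TTheory GRing.Theory Num.Theory.
Import numFieldNormedType.Exports.

Local Open Scope classical_set_scope.
Local Open Scope ring_scope.

Inductive btree : Type := Leaf | Node of btree & btree.

Fixpoint btree_encode (t : btree) : GenTree.tree unit :=
  match t with
  | Leaf => GenTree.Leaf tt
  | Node u v => GenTree.Node 0 [:: btree_encode u; btree_encode v]
  end.

Fixpoint btree_decode (g : GenTree.tree unit) : option btree :=
  match g with
  | GenTree.Leaf _ => Some Leaf
  | GenTree.Node _ [:: g1; g2] =>
      match btree_decode g1, btree_decode g2 with
      | Some u, Some v => Some (Node u v)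
      | _, _ => None
      end
  | _ => None
  end.

Lemma btree_encodeK : pcancel btree_encode btree_decode.
Proof. by elim=> [|u IHu v IHv] //=; rewrite IHu IHv. Qed.

HB.instance Definition _ := Countable.copy btree (pcan_type btree_encodeK).

Fixpoint leaves (t : btree) : nat :=
  match t with
  | Leaf => 1
  | Node u v => leaves u + leaves v
  end.

Fixpoint subtrees (t : btree) : seq btree :=
  t :: match t with
       | Leaf => [::]
       | Node u v => subtrees u ++ subtrees v
       end.

(* Binary trees are ordered terms, so two subtrees are isomorphic exactly
   when they are equal. *)
Definition dag_size (t : btree) : nat := size (undup (subtrees t)).

Section Sources.
Variable R : realType.
Implicit Types sigma : nat -> nat -> R.

(* The values of [sigma] at arguments equal to [0] are irrelevant: they are
   unconstrained here and never used below. *)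
Definition in_Sigma sigma : Prop :=
  (forall i j, (0 < i)%N -> (0 < j)%N -> 0 <= sigma i j <= 1) /\
  (forall k, (2 <= k)%N -> \sum_(1 <= i < k) sigma i (k - i)%N = 1).

Fixpoint tree_prob sigma (t : btree) : R :=
  match t with
  | Leaf => 1
  | Node u v => sigma (leaves u) (leaves v) * tree_prob sigma u * tree_prob sigma v
  end.

Definition avg_dag_size sigma (n : nat) : R :=
  \sum_(t \in [set t : btree | leaves t = n])
     tree_prob sigma t * (dag_size t)%:R.

Definition sigma_star sigma (i j : nat) : R :=
  if i == j then sigma i j else sigma i j + sigma j i.

Definition log4 (x : R) : R := ln x / ln 4.

End Sources.

Lemma leaves_gt0 t : (0 < leaves t)%N.
Proof. by elim: t => //= u IHu v _; rewrite addn_gt0 IHu. Qed.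

(* [\sum_(t \in A) F t] would silently be [0] on an infinite support; this
   guarantees that [avg_dag_size] is the genuine sum over all trees. *)
Lemma finite_set_leaves n : finite_set [set t : btree | leaves t = n].
Proof.
have [s sP] : exists s : seq btree, forall t, (leaves t <= n)%N -> t \in s.
  elim: n => [|n [s sP]].
    by exists [::] => t; have := leaves_gt0 t; case: (leaves t).
  exists (Leaf :: [seq Node u v | u <- s, v <- s]) => -[|u v] /= tn.
    by rewrite inE.
  rewrite inE; apply/orP; right; apply/allpairsP; exists (u, v).
  have u0 := leaves_gt0 u; have v0 := leaves_gt0 v.
  split=> //=; apply: sP; rewrite -ltnS; apply: leq_trans tn.
    by rewrite -addn1 leq_add2l.
  by rewrite -add1n leq_add2r.
apply: (sub_finite_set _ (finite_seq s)) => t /= tn.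
by apply: sP; rewrite tn.
Qed.

(* Main.v *)
(* Fix a threshold [m]. The distinct subtrees of a tree with at most [m] leaves
   number at most [4 ^ m]; the other ones are at most as many as the nodes
   spanning more than [m] leaves. If [sigma^* <= c] above [m], induction on [n]
   bounds the expected number of such nodes by [4 c n - 2]. With
   [b = log4 n / 2], [m = floor b] and [c = psi b], one has
   [4 ^ m <= sqrt n], which is [O(psi b * n)] since [psi b >= 2 / (b - 1)]. *)
Require Import Defs.
From HB Require Import structures.
From mathcomp Require Import all_boot all_order all_algebra.
From mathcomp Require Import all_classical all_reals all_analysis.
From mathcomp Require Import zify ring lra.

Set Implicit Arguments.
Unset Strict Implicit.
Unset Printing Implicit Defensive.

Import Order.TTheory GRing.Theory Num.Theory.
Import numFieldNormedType.Exports.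

Local Open Scope classical_set_scope.
Local Open Scope ring_scope.

(** * Counting small trees and large subtrees *)

(* A prefix-free code of length [2 * leaves t - 1]. *)
Fixpoint btree_bits (t : btree) : bitseq :=
  match t with
  | Leaf => [:: false]
  | Node u v => true :: btree_bits u ++ btree_bits v
  end.

Lemma size_btree_bits t : (size (btree_bits t)).+1 = (leaves t).*2.
Proof. by elim: t => //= u IHu v IHv; rewrite size_cat doubleD -IHu -IHv addnS. Qed.

(** The arbitrary tails carry the induction: the code of a left subtree is followed by that of its
    sibling. *)
Lemma btree_bits_prefix t t' s s' :
  btree_bits t ++ s = btree_bits t' ++ s' -> t = t' /\ s = s'.
Proof.
elim: t t' s s' => [|u IHu v IHv] [|u' v'] s s' //=; first by case.
by case; rewrite -!catA => /IHu[-> /IHv[-> ->]].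
Qed.

Lemma size_uniq_leaves_le (m : nat) (s : seq btree) :
  uniq s -> all (fun t => (leaves t <= m)%N) s -> (size s <= 4 ^ m)%N.
Proof.
move=> s_uniq /allP s_le.
(* Padding to the common length [2 * m] stays injective because the code is prefix-free; there are
   [2 ^ (2 * m) = 4 ^ m] such words. *)
pose code t := btree_bits t ++ nseq (m.*2 - size (btree_bits t)) false.
have codeP t : t \in s -> size (code t) == m.*2.
  move=> /s_le; rewrite /= size_cat size_nseq; have := size_btree_bits t; lia.
rewrite (_ : 4 ^ m = #|{: m.*2.-tuple bool}|)%N; last first.
  by rewrite card_tuple card_bool -muln2 mulnC expnM.
rewrite -(size_map code) cardE -(size_map val).
apply: uniq_leq_size.
  by rewrite map_inj_uniq // => t t' /btree_bits_prefix[].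
move=> _ /mapP[t ts ->]; apply/mapP; exists (Tuple (codeP t ts)) => //.
by rewrite mem_enum.
Qed.

(** Occurrences are counted with multiplicity, unlike in [dag_size], so that the count is additive
    over the two children. *)
Definition big_nodes (m : nat) (t : btree) : nat :=
  count (fun s => (m < leaves s)%N) (subtrees t).

Lemma leaves_subtree t s : s \in subtrees t -> (leaves s <= leaves t)%N.
Proof.
elim: t => [|u IHu v IHv] /=; rewrite inE; first by move=> /eqP ->.
by rewrite mem_cat => /or3P[/eqP -> //|/IHu|/IHv]; lia.
Qed.

Lemma big_nodes_small m t : (leaves t <= m)%N -> big_nodes m t = 0%N.
Proof.
move=> tm; apply/eqP; rewrite -leqn0 leqNgt -has_count; apply/hasPn => s.
by move=> /leaves_subtree st; rewrite -leqNgt (leq_trans st).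
Qed.

Lemma big_nodes_node m u v : (m < leaves (Node u v))%N ->
  big_nodes m (Node u v) = (1 + big_nodes m u + big_nodes m v)%N.
Proof. by rewrite /big_nodes /= count_cat => ->; rewrite addnA. Qed.

Lemma dag_size_le m t : (dag_size t <= 4 ^ m + big_nodes m t)%N.
Proof.
rewrite /dag_size -(count_predC (fun s => (leaves s <= m)%N)) leq_add //.
  rewrite -size_filter size_uniq_leaves_le ?filter_all //.
  by rewrite filter_uniq ?undup_uniq.
apply: leq_trans (count_undup _ _) _; rewrite /big_nodes leq_eqVlt; apply/orP.
by left; apply/eqP/eq_count => s /=; rewrite ltnNge.
Qed.

(** * Enumeration of the trees with [n] leaves *)

Definition trees (n : nat) : seq btree :=
  finmap.enum_fset (fset_set [set t | leaves t = n]).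

Lemma trees_uniq n : uniq (trees n).
Proof. exact: finmap.fset_uniq. Qed.

Lemma mem_trees n t : (t \in trees n) = (leaves t == n).
Proof.
rewrite (in_fset_set (finite_set_leaves n)).
by apply/idP/eqP => [/set_mem //|tn]; apply: mem_set.
Qed.

Lemma trees1 : perm_eq (trees 1) [:: Leaf].
Proof.
apply: uniq_perm => // [|[|u v]]; rewrite ?trees_uniq // mem_trees ?inE //.
have u0 := leaves_gt0 u; have v0 := leaves_gt0 v.
by apply/eqP => /=; lia.
Qed.

Lemma sum_trees_node (V : nmodType) (F : btree -> V) (n : nat) : (1 < n)%N ->
  \sum_(t <- trees n) F t =
  \sum_(1 <= k < n) \sum_(u <- trees k) \sum_(v <- trees (n - k)) F (Node u v).
Proof.
move=> n1.
pose s := [seq Node p.1 p.2 | k <- index_iota 1 n,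
             p <- [seq (u, v) | u <- trees k, v <- trees (n - k)]].
rewrite (perm_big s) /=.
  rewrite big_allpairs_dep; apply: eq_bigr => k _.
  by rewrite big_allpairs_dep.
apply: uniq_perm => [||t]; first exact: trees_uniq.
  apply: allpairs_uniq_dep; first exact: iota_uniq.
    move=> k _; apply: allpairs_uniq; rewrite ?trees_uniq //.
    by move=> [? ?] [? ?].
  (* No tree is listed twice: [k] is recovered as the number of leaves of the left child. *)
  move=> x y /allpairsPdep[k [p [_ pk ->]]] /allpairsPdep[k' [p' [_ pk' ->]]] /=.
  case: p p' pk pk' => u v [u' v'] /allpairsP[[u1 v1] [/= + _ [-> ->]]].
  rewrite mem_trees => /eqP <- /allpairsP[[u2 v2] [/= + _ [-> ->]]].
  by rewrite mem_trees => /eqP <- [-> ->].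
rewrite mem_trees; apply/eqP/allpairsPdep => [|[k [[u v] [kn + ->]]]].
  case: t => [|u v] /= tn; first by rewrite -tn in n1.
  have u0 := leaves_gt0 u; have v0 := leaves_gt0 v.
  exists (leaves u), (u, v); split=> //; first by rewrite mem_index_iota; lia.
  by apply/allpairsP; exists (u, v); split=> //=; rewrite mem_trees; apply/eqP; lia.
move=> /allpairsP[[u1 v1] [/= + + [-> ->]]] /=.
by rewrite mem_index_iota in kn; rewrite !mem_trees => /eqP -> /eqP ->; lia.
Qed.

(* Telescoping against [k |-> max 0 (b - a k) ^ 2 / (2 a)]. *)
Lemma sum_posB_le (R : realType) (a b : R) (n : nat) : 0 < a -> 0 <= b ->
  \sum_(1 <= k < n) Num.max 0 (b - a * k%:R) <= b ^+ 2 / (2 * a).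
Proof.
move=> a0 b0; pose h k : R := Num.max 0 (b - a * k%:R) ^+ 2 / (2 * a).
have h0 : h 0%N = b ^+ 2 / (2 * a) by rewrite /h mulr0 subr0 max_r.
have hstep k : Num.max 0 (b - a * k.+1%:R) <= h k - h k.+1.
  rewrite /h -mulrBl ler_pdivlMr; last lra.
  set x := b - a * k.+1%:R.
  have -> : b - a * k%:R = x + a by rewrite /x -[k.+1]addn1 natrD; lra.
  have := sqr_ge0 (Num.max 0 (x + a)).
  (* For [x <= 0] the left side vanishes; otherwise [(x + a) ^ 2 - x ^ 2 >= 2 * a * x]. *)
  have [x0|x0] := lerP x 0; first by lra.
  by rewrite !max_r; nra.
have hge0 k : 0 <= h k by rewrite /h divr_ge0 ?sqr_ge0 //; lra.
rewrite big_add1 -h0; apply: (@le_trans _ _ (\sum_(0 <= k < n.-1) (h k - h k.+1))).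
  by apply: ler_sum => k _; exact: hstep.
under eq_bigr do rewrite -opprB.
by rewrite sumrN telescope_sumr // opprB lerBlDr lerDl.
Qed.

(** * Averages over the trees with [n] leaves *)

Section Mean.
Variables (R : realType) (sigma : nat -> nat -> R).
Hypothesis sigmaS : in_Sigma sigma.

Definition mean (F : btree -> R) (n : nat) : R :=
  \sum_(t <- trees n) tree_prob sigma t * F t.

Lemma avg_dag_sizeE n : avg_dag_size sigma n = mean (fun t => (dag_size t)%:R) n.
Proof. by rewrite /avg_dag_size fsbig_finite //; exact: finite_set_leaves. Qed.

Lemma tree_prob_ge0 t : 0 <= tree_prob sigma t.
Proof.
elim: t => //= u IHu v IHv; rewrite !mulr_ge0 //.
by case: sigmaS => + _ => /(_ _ _ (leaves_gt0 u) (leaves_gt0 v))/andP[].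
Qed.

Lemma mean_node F n : (1 < n)%N ->
  mean F n = \sum_(1 <= k < n) sigma k (n - k) *
    mean (fun u => mean (fun v => F (Node u v)) (n - k)) k.
Proof.
move=> n1; rewrite /mean sum_trees_node //; apply: eq_bigr => k _.
rewrite mulr_sumr big_seq [RHS]big_seq; apply: eq_bigr => u.
rewrite mem_trees => /eqP uk; rewrite !mulr_sumr big_seq [RHS]big_seq.
by apply: eq_bigr => v; rewrite mem_trees /= uk => /eqP ->; rewrite !mulrA.
Qed.

Lemma meanD F G n : mean (fun t => F t + G t) n = mean F n + mean G n.
Proof. by rewrite /mean -big_split; apply: eq_bigr => t _; rewrite mulrDr. Qed.

Lemma mean_le F G n : (forall t, leaves t = n -> F t <= G t) ->
  mean F n <= mean G n.
Proof.
move=> FG; rewrite /mean big_seq [leRHS]big_seq; apply: ler_sum => t.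
by rewrite mem_trees => /eqP /FG; apply: ler_wpM2l; exact: tree_prob_ge0.
Qed.

Lemma eq_mean F G n : (forall t, leaves t = n -> F t = G t) ->
  mean F n = mean G n.
Proof. by move=> FG; apply/eqP; rewrite eq_le !mean_le // => t /FG ->. Qed.

(** By induction both inner means are constant, and the root weights sum to 1. Thus [tree_prob] is a
    probability distribution on the trees of each size. *)
Lemma mean_cst c n : (0 < n)%N -> mean (fun=> c) n = c.
Proof.
have [N] := ubnP n; elim: N n c => // N IH [//|[|n]] c nN _.
  by rewrite /mean (perm_big _ trees1) big_seq1 mul1r.
rewrite mean_node //; case: sigmaS => _ /(_ n.+2 isT) s1.
rewrite -[RHS]mul1r -s1 mulr_suml big_nat [RHS]big_nat.
by apply: eq_bigr => k kn; rewrite !IH //; lia.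
Qed.

Lemma sum_sigma_swap (F : nat -> R) n :
  \sum_(1 <= k < n) sigma k (n - k)%N * F (n - k)%N =
  \sum_(1 <= k < n) sigma (n - k)%N k * F k.
Proof.
rewrite big_nat_rev /= big_nat [RHS]big_nat; apply: eq_bigr => k kn.
by rewrite (_ : 1 + n - k.+1 = n - k)%N ?subKn //; lia.
Qed.

(** Reflecting [k] to [n - k] in the contribution of the right child merges both children into one
    sum with symmetrised weights. *)
Lemma sum_split_sigma (F : nat -> R) n :
  \sum_(1 <= k < n) sigma k (n - k)%N * (F k + F (n - k)%N) =
  \sum_(1 <= k < n) (sigma k (n - k)%N + sigma (n - k)%N k) * F k.
Proof.
under eq_bigr do rewrite mulrDr; rewrite big_split /= sum_sigma_swap -big_split.
by apply: eq_bigr => k _; rewrite mulrDl.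
Qed.

(** * Expected number of nodes spanning more than [m] leaves *)

Definition mean_big (m n : nat) : R := mean (fun t => (big_nodes m t)%:R) n.

Lemma mean_big_small m n : (0 < n <= m)%N -> mean_big m n = 0.
Proof.
move=> /andP[n0 nm]; rewrite -[RHS](mean_cst 0 n0); apply: eq_mean => t tn.
by rewrite big_nodes_small // tn.
Qed.

(** The root contributes 1. Each child contributes its own mean, since the probabilities of its
    sibling sum to 1. *)
Lemma mean_big_rec m n : (1 < n)%N -> (m < n)%N ->
  mean_big m n = 1 + \sum_(1 <= k < n)
    (sigma k (n - k)%N + sigma (n - k)%N k) * mean_big m k.
Proof.
move=> n1 mn; rewrite -sum_split_sigma /mean_big mean_node //.
case: sigmaS => _ /(_ n n1) s1; rewrite -[X in X + _]s1 -big_split /=.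
rewrite big_nat [RHS]big_nat; apply: eq_bigr => k kn.
rewrite -[X in X + _]mulr1 -mulrDr; congr (_ * _).
have k0 : (0 < k)%N by lia.
have nk0 : (0 < n - k)%N by lia.
transitivity (mean (fun u => (1 + (big_nodes m u)%:R) +
                             mean_big m (n - k)) k).
  apply: eq_mean => u uk; rewrite -[X in X + _](mean_cst _ nk0) -meanD.
  apply: eq_mean => v vk; rewrite big_nodes_node ?natrD ?natrD //=.
  by rewrite uk vk; lia.
by rewrite !meanD !mean_cst // addrA.
Qed.

(** The factor 2 comes from the diagonal [k = n - k], where [sigma_star] counts [sigma] only
    once. *)
Lemma sigma_sym_le k n (c : R) : (1 <= k < n)%N -> sigma_star sigma k (n - k)%N <= c ->
  0 <= sigma k (n - k)%N + sigma (n - k)%N k <= 2 * c.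
Proof.
move=> kn; have k0 : (0 < k)%N by lia.
have nk0 : (0 < n - k)%N by lia.
case: sigmaS => sI _; have /andP[s0 _] := sI _ _ k0 nk0.
have /andP[s0' _] := sI _ _ nk0 k0.
by rewrite /sigma_star; case: eqP => [kk|_]; [rewrite -kk in s0 * |] => sc; lra.
Qed.

(* The term [- 2] is what makes the induction close: each node splits the
   linear part exactly but doubles the constant, and this gain of [2] pays for
   the node itself and for the small subtrees, where the bound is negative. *)
Lemma mean_big_le m (c : R) n : (0 < m)%N -> 0 < c ->
  (forall N k, (m < N)%N -> (1 <= k < N)%N -> sigma_star sigma k (N - k)%N <= c) ->
  (m < n)%N -> mean_big m n <= 4 * c * n%:R - 2.
Proof.
move=> m0 c0 star_le; have [N] := ubnP n; elim: N n => // N IH n nN mn.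
have n1 : (1 < n)%N by lia.
rewrite mean_big_rec //.
pose tau k := sigma k (n - k)%N + sigma (n - k)%N k.
(* [g k] is how far the claimed bound falls below 0; adding it gives a bound valid also for
   [k <= m], where the mean is 0. *)
pose g k : R := Num.max 0 (2 - 4 * c * k%:R).
have term k : (1 <= k < n)%N ->
    tau k * mean_big m k <= tau k * (4 * c * k%:R - 2) + 2 * c * g k.
  move=> kn; have /andP[t0 tc] := sigma_sym_le kn (star_le _ _ mn kn).
  have g0 : 0 <= g k by rewrite /g le_max lexx.
  have g2 : 2 - 4 * c * k%:R <= g k by rewrite /g le_max lexx orbT.
  have E : mean_big m k <= 4 * c * k%:R - 2 + g k.
    have [km|mk] := leqP k m; first by rewrite mean_big_small; [lra | lia].
    by have := IH k ltac:(lia) mk; lra.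
  by rewrite -/(tau k) in t0 tc *; nra.
(* Undoing the symmetrisation, the bounds at [k] and [n - k] add up to [4 * c * n - 4], whatever [k]
   is. *)
have sum_tau : \sum_(1 <= k < n) tau k * (4 * c * k%:R - 2) = 4 * c * n%:R - 4.
  rewrite -(sum_split_sigma (fun k => 4 * c * k%:R - 2)).
  transitivity (\sum_(1 <= k < n) sigma k (n - k)%N * (4 * c * n%:R - 4)).
    rewrite big_nat [RHS]big_nat; apply: eq_bigr => k kn; congr (_ * _).
    by rewrite natrB; [lra | lia].
  by rewrite -mulr_suml; case: sigmaS => _ ->; rewrite ?mul1r.
(* With [a = 4 * c] and [b = 2], the telescoping bound is [1 / (2 * c)]. *)
have sum_g : 2 * c * \sum_(1 <= k < n) g k <= 1.
  have := @sum_posB_le R (4 * c) 2 n ltac:(lra) ltac:(lra).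
  rewrite ler_pdivlMr; last lra.
  by rewrite -/(g _); lra.
have : \sum_(1 <= k < n) tau k * mean_big m k <=
       \sum_(1 <= k < n) (tau k * (4 * c * k%:R - 2) + 2 * c * g k).
  by rewrite big_nat [leRHS]big_nat; apply: ler_sum => k; exact: term.
(* Root, linear part and corrections total [1 + (4 * c * n - 4) + 1]. *)
by rewrite big_split /= -mulr_sumr sum_tau; lra.
Qed.

Lemma avg_dag_size_le m (c : R) n : (0 < m < n)%N -> 0 < c ->
  (forall N k, (m < N)%N -> (1 <= k < N)%N -> sigma_star sigma k (N - k)%N <= c) ->
  avg_dag_size sigma n <= 4 ^+ m + 4 * c * n%:R.
Proof.
move=> /andP[m0 mn] c0 star_le; rewrite avg_dag_sizeE.
apply: (@le_trans _ _ (mean (fun t => 4 ^+ m + (big_nodes m t)%:R) n)).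
  by apply: mean_le => t _; rewrite -natrX -natrD ler_nat dag_size_le.
rewrite meanD mean_cst ?(leq_trans _ mn) // lerD2l.
by have := mean_big_le m0 c0 star_le mn; rewrite /mean_big; lra.
Qed.

Lemma avg_dag_size_ge0 n : 0 <= avg_dag_size sigma n.
Proof.
by rewrite avg_dag_sizeE; apply: sumr_ge0 => t _; rewrite mulr_ge0 ?tree_prob_ge0.
Qed.

End Mean.

(** * Choice of the threshold and asymptotics *)

(** Since [4 ^ (2 * b) = n], rounding [b] down can only decrease the power. *)
Lemma log4_truncn (R : realType) (n : nat) (b : R) : (0 < n)%N ->
  b = 1 / 2 * log4 n%:R -> 4 ^+ Num.truncn b * 4 ^+ Num.truncn b <= n%:R :> R.
Proof.
move=> n0 bE; have n1 : 1 <= n%:R :> R by rewrite ler1n.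
have l4 : 0 < ln 4 :> R by rewrite ln_gt0 //; lra.
have lnE : ln n%:R = b * (2 * ln 4) by rewrite bE /log4; field; rewrite gt_eqF.
have b0 : 0 <= b by have := ln_ge0 n1; rewrite lnE; nra.
have /andP[mb _] := truncn_itv b0.
rewrite -exprD -ler_ln ?posrE ?exprn_gt0 //; try lra.
by rewrite lnXn; [rewrite lnE -[ln 4 *+ _]mulr_natr natrD; nra | lra].
Qed.

Lemma half_log4_near_gt (R : realType) (A : R) :
  \forall n \near \oo, A < 1 / 2 * log4 (n%:R : R).
Proof.
have l4 : 0 < ln 4 :> R by rewrite ln_gt0 //; lra.
near=> n.
have : expR (2 * A * ln 4) < n%:R :> R by near: n; exact: nbhs_infty_gtr.
rewrite -{1}(@lnK _ n%:R) ?posrE ?ltr0n; last by near: n; exact: nbhs_infty_gt.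
rewrite ltr_expR /log4 -ltr_pdivlMr //; lra.
Unshelve. all: by end_near. Qed.

Theorem theorem3p3 (R : realType) (psi : R -> R) (sigma : nat -> nat -> R)
  (psi_range : forall x : R, 0 < psi x <= 1)
  (psi_decr : forall x y : R, x <= y -> psi y <= psi x)
  (psi_lb : \forall x \near +oo, 2 / (x - 1) <= psi x)
  (sigma_Sigma : in_Sigma sigma)
  (sigma_psi : \forall n \near \oo, forall k : nat,
     (1 <= k <= n - 1)%N -> sigma_star sigma k (n - k)%N <= psi n%:R) :
  (fun n : nat => avg_dag_size sigma n : R^o) =O_\oo
  (fun n : nat => psi (1 / 2 * log4 (n%:R)) * n%:R : R^o).
Proof.
have [M [_ psi_lbM]] := psi_lb; have [N0 _ sigma_psiN] := sigma_psi.
(* Of the constant 5, 4 comes from the large nodes and 1 from [4 ^ m <= psi b * n]. *)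
apply/eqO_exP; exists 5 => //; near=> n; rewrite /=.
have n0 : (0 < n)%N by near: n; exact: nbhs_infty_gt.
have bM : M < 1 / 2 * log4 n%:R by near: n; exact: half_log4_near_gt.
(* The hypothesis on [sigma] is used at every size above [m], not just at [n], so [b] itself must
   exceed [N0]. *)
have bN0 : N0%:R < 1 / 2 * log4 n%:R :> R by near: n; exact: half_log4_near_gt.
have b1 : 1 < 1 / 2 * log4 n%:R :> R by near: n; exact: half_log4_near_gt.
set b := 1 / 2 * log4 n%:R in bM bN0 b1 *; pose m := Num.truncn b.
have /andP[psi0 _] := psi_range b.
have b0 : 0 <= b by lra.
have /andP[mb bm] : m%:R <= b < m.+1%:R := truncn_itv b0.
have m_exp : b <= 4 ^+ m by rewrite (le_trans (ltW bm)) // -natrX ler_nat ltn_expl.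
have exp_n : 4 ^+ m * 4 ^+ m <= n%:R :> R := log4_truncn n0 erefl.
have m0 : (0 < m)%N by rewrite truncn_gt0 ltW.
have mn : (m < n)%N.
  rewrite -(ltr_nat R) (lt_le_trans _ exp_n) //.
  by rewrite -natrX -natrM ltr_nat (leq_trans (@ltn_expl 4 m isT)) ?leq_pmulr ?expn_gt0.
(* A size [N > m] is at least [b], so [psi N <= psi b] by monotonicity. *)
have star_le N k : (m < N)%N -> (1 <= k < N)%N -> sigma_star sigma k (N - k)%N <= psi b.
  move=> mN kN; have bN : b <= N%:R by rewrite (le_trans (ltW bm)) // ler_nat.
  apply: le_trans (psi_decr _ _ bN); apply: sigma_psiN => /=.
    by rewrite -(ler_nat R) ltW // (lt_le_trans bN0).
  by case/andP: kN => -> kN /=; rewrite -ltnS subn1 prednK // (leq_ltn_trans _ mN).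
have avg_le := avg_dag_size_le sigma_Sigma (introT andP (conj m0 mn)) psi0 star_le.
rewrite ger0_norm; last exact: avg_dag_size_ge0.
rewrite ger0_norm; last by rewrite mulr_ge0 // ltW.
have pow0 : 0 < 4 ^+ m :> R by rewrite exprn_gt0.
have psi_ge : 2 <= psi b * (b - 1) by rewrite -ler_pdivrMr ?psi_lbM // subr_gt0.
apply: le_trans avg_le _; move: pow0 m_exp exp_n psi0 psi_ge.
move: (4 ^+ m) (psi b) n%:R => p c x p0 bp px c0 c_ge.
(* Here [p = 4 ^ m] is at least [b], so [2 <= c * (b - 1) <= c * p]; multiplying by [p] and using
   [p * p <= x] gives [p <= c * x]. *)
have cp : 2 <= c * p by nra.
suff : p <= c * x by lra.
by nra.
Unshelve. all: by end_near. Qed.
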